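(* Let $X$ be a complex Hilbert space and let $$H=\begin{pmatrix} A & B\\ C & -A^*\end{pmatrix}$$ be a Hamiltonian operator matrix on $X\times X$. Suppose that $\mathcal{D}(H)=\mathcal{D}(A)\times\mathcal{D}(A^* )$ and that $\rho(A)\neq\emptyset$. Then $JH=(JH)^*$ if one of the following holds: (1) $C$ is $A$-bounded with relative bound $0$; (2) $B$ is $A^*$-bounded with relative bound $0$.
   Context: All operators are linear and possibly unbounded; $\mathcal{D}(T)$ denotes the domain and $\rho(T)$ the resolvent set of $T$. Block operator matrix: for operators $A,B,C,D$ in $X$, the matrix $H=\begin{pmatrix} A&B\\ C&D\end{pmatrix}$ denotes the operator on $X\times X$ with domain $\mathcal{D}(H)=(\mathcal{D}(A)\cap\mathcal{D}(C))\times(\mathcal{D}(B)\cap\mathcal{D}(D))$ and action $H(x_1,x_2)^t=(Ax_1+Bx_2,\;Cx_1+Dx_2)^t$. Hamiltonian operator matrix: a block operator matrix $H=\begin{pmatrix} A&B\\ C&-A^*\end{pmatrix}$ on $X\times X$, $X$ a complex Hilbert space, where $A,B,C$ are closed densely defined operators in $X$, $B$ and $C$ are self-adjoint, and $H$ is densely defined. $J=\begin{pmatrix}0&I\\-I&0\end{pmatrix}$ on $X\times X$. Relative boundedness: $S$ is $T$-bounded if $\mathcal{D}(T)\subset\mathcal{D}(S)$ and there are $a,b\ge 0$ with $\|Sx\|\le a\|Tx\|+b\|x\|$ for all $x\in\mathcal{D}(T)$; the relative bound is the infimum of all such $a$. *)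

(* Defs.v *)
From mathcomp Require Import all_boot all_order all_algebra.
From mathcomp Require Import sesquilinear complex.
From mathcomp Require Import all_classical all_reals all_analysis.

Set Implicit Arguments.
Unset Strict Implicit.
Unset Printing Implicit Defensive.

Import Order.TTheory GRing.Theory Num.Theory.
Import numFieldNormedType.Exports.

Local Open Scope classical_set_scope.
Local Open Scope ring_scope.

(* A possibly unbounded operator: the values of [app] outside [dom] are
   irrelevant, so operators are compared with [eq_operator] rather than [=].
   Linearity is the separate predicate [linear_op]. *)
Record operator (U V : Type) := Operator { dom : set U; app :> U -> V }.

Definition eq_operator (U V : Type) (S T : operator U V) : Prop :=
  dom S = dom T /\ forall x, dom T x -> S x = T x.

Section Algebra.
Context {K : numFieldType}.

Definition linear_op (U V : lmodType K) (T : operator U V) : Prop :=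
  dom T 0 /\
  forall (a : K) (x y : U), dom T x -> dom T y ->
    dom T (a *: x + y) /\ T (a *: x + y) = a *: T x + T y.

Definition zero_op (U V : lmodType K) : operator U V :=
  Operator setT (fun=> 0).

Definition id_op (U : lmodType K) : operator U U := Operator setT id.

Definition opp_op (U V : lmodType K) (T : operator U V) : operator U V :=
  Operator (dom T) (fun x => - T x).

Definition comp_op (U V W : lmodType K) (S : operator V W) (T : operator U V) :
    operator U W :=
  Operator (dom T `&` T @^-1` dom S) (fun x => S (T x)).

Definition block_op (U : lmodType K) (A B C D : operator U U) :
    operator (U * U)%type (U * U)%type :=
  Operator ((dom A `&` dom C) `*` (dom B `&` dom D))
           (fun x => (A x.1 + B x.2, C x.1 + D x.2)).

Definition J_op (U : lmodType K) : operator (U * U)%type (U * U)%type :=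
  block_op (zero_op U U) (id_op U) (opp_op (id_op U)) (zero_op U U).

(* [adjoint ip T] is the adjoint of [T] with respect to the inner product
   [ip]. When [T] is densely defined the [z] below is unique, so the choice
   made by [xget] is immaterial. *)
Definition adjoint_rel (U : lmodType K) (ip : U -> U -> K) (T : operator U U)
    (y z : U) : Prop :=
  forall x, dom T x -> ip (T x) y = ip x z.

Definition adjoint (U : lmodType K) (ip : U -> U -> K) (T : operator U U) :
    operator U U :=
  Operator [set y | exists z, adjoint_rel ip T y z]
           (fun y => xget 0 (adjoint_rel ip T y)).

Definition self_adjoint (U : lmodType K) (ip : U -> U -> K)
    (T : operator U U) : Prop :=
  eq_operator T (adjoint ip T).

(* The library norm of [U * U] is the max norm, which does not come from an
   inner product; it is equivalent to the norm of [prod_ip], so both give the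
   same topology. *)
Definition prod_ip (U : lmodType K) (ip : U -> U -> K) (x y : U * U) : K :=
  ip x.1 y.1 + ip x.2 y.2.

End Algebra.

Definition densely_defined (U : topologicalType) (V : Type)
    (T : operator U V) : Prop :=
  dense (dom T).

Definition closed_op (U V : topologicalType) (T : operator U V) : Prop :=
  closed [set (x, T x) | x in dom T].

Section ComplexSpaces.
Context {R : realType}.

(* A complex Hilbert space is a complete normed module over [R[i]] whose norm
   comes from an inner product (linear on the left). The norm takes its values
   in [R[i]]. *)
Definition norm_from_dot (X : normedModType R[i]) (dot : {dot X for Num.conj}) :
    Prop :=
  forall x : X, `|x| ^+ 2 = dot x x.

Definition resolvent_set (X : normedModType R[i]) (A : operator X X) :
    set R[i] :=
  [set lambda |
     set_bij (dom A) setT (fun x => A x - lambda *: x) /\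
     exists M : R, forall x, dom A x -> `|x| <= M%:C%C * `|A x - lambda *: x|].

Definition rel_bound_const (X : normedModType R[i]) (S T : operator X X)
    (a : R) : Prop :=
  0 <= a /\ exists b : R, 0 <= b /\
    forall x, dom T x -> `|S x| <= a%:C%C * `|T x| + b%:C%C * `|x|.

Definition rel_bounded (X : normedModType R[i]) (S T : operator X X) : Prop :=
  dom T `<=` dom S /\ exists a : R, rel_bound_const S T a.

(* Meaningful only when [rel_bounded S T]: the infimum of the empty set is 0. *)
Definition rel_bound (X : normedModType R[i]) (S T : operator X X) : R :=
  inf [set a : R | rel_bound_const S T a].

Definition hamiltonian_op (X : normedModType R[i]) (dot : {dot X for Num.conj})
    (A B C : operator X X) : operator (X * X)%type (X * X)%type :=
  block_op A B C (opp_op (adjoint dot A)).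

Definition is_hamiltonian (X : normedModType R[i]) (dot : {dot X for Num.conj})
    (A B C : operator X X) : Prop :=
  [/\ [/\ linear_op A, closed_op A & densely_defined A],
      [/\ linear_op B, closed_op B & densely_defined B],
      [/\ linear_op C, closed_op C & densely_defined C],
      self_adjoint dot B /\ self_adjoint dot C
    & densely_defined (hamiltonian_op dot A B C)].

End ComplexSpaces.

(* Main.v *)
Require Import Defs.
From mathcomp Require Import all_boot all_order all_algebra.
From mathcomp Require Import sesquilinear complex.
From mathcomp Require Import all_classical all_reals all_analysis.
From mathcomp Require Import ring lra.

Set Implicit Arguments.
Unset Strict Implicit.
Unset Printing Implicit Defensive.

Import Order.TTheory GRing.Theory Num.Theory.
Import numFieldNormedType.Exports.
Import ComplexField.Normc.

Local Open Scope classical_set_scope.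
Local Open Scope ring_scope.

(** Write [As] for the adjoint of [A].  The operator [JH] acts on
    [dom A `*` dom As] by [(x1, x2) |-> (C x1 - As x2, - A x1 - B x2)], and it
    is the sum of a self-adjoint operator and a small symmetric one.

    In case (1), drop the corner [C].  What remains,
    [(x1, x2) |-> (- As x2, - A x1 - B x2)], is self-adjoint by inspection:
    testing the adjoint relation on [(x1, 0)] puts [y2] in [dom As], hence in
    [dom B]; then [B] can be moved to the other side by symmetry, and testing
    on [(0, x2)] puts [y1] in the domain of the adjoint of [As], which is
    [dom A] ([corner_free_self_adjoint]).  The corner [C] is restored by the
    Kato-Rellich theorem ([kato_rellich]), which needs [C] to be small with
    respect to the corner-free operator.  Smallness with respect to [A] is
    given, so it remains to control [A x1] by [A x1 + B x2] and [As x2], that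
    is, to know that [B] is [As]-bounded ([block_self_adjoint]).

    That bound is automatic ([symmetric_rel_bounded]): if [G] is a resolvent of
    [As], then [B G] is defined everywhere and has a formal adjoint on the
    dense set [dom B], so it is bounded by a nested-balls argument
    ([formal_adjoint_bounded]).  The nonempty resolvent set of [A] serves here,
    and also gives a resolvent of [As] through the Riesz representation theorem
    and the reflexivity [dom A = dom (adjoint As)] ([adjoint_dual_pair]).

    Case (2) is case (1) for the dual pair [(As, A)] with the corners [- B] and
    [C], up to exchanging the two components of [X * X] ([swap_self_adjoint]).

    The general theory is developed for a complex vector space with a complete
    positive definite Hermitian form, with real epsilons for the norm of the
    form.  In this way it applies to [X * X] with [prod_ip], whose form does not
    induce the max norm that [X * X] carries. *)

(** * Hilbert forms *)

Section HilbertForms.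
Context {R : realType}.

Definition form_norm (E : lmodType R[i]) (ip : E -> E -> R[i]) (x : E) : R :=
  Num.sqrt (complex.Re (ip x x)).

(** Completeness is stated with the norm of the form itself, so that no
    topology on [E] is involved. *)
Record hilbert_form (E : lmodType R[i]) (ip : E -> E -> R[i]) : Prop := {
  formP : forall a x y z, ip (a *: x + y) z = a * ip x z + ip y z;
  formC : forall x y, ip y x = (ip x y)^*;
  form_ge0 : forall x, 0 <= ip x x;
  form_eq0 : forall x, ip x x = 0 -> x = 0;
  form_complete : forall u : nat -> E,
    (forall e : R, 0 < e -> exists N, forall m n, (N <= m)%N -> (N <= n)%N ->
       form_norm ip (u m - u n) < e) ->
    exists l, forall e : R, 0 < e -> exists N, forall n, (N <= n)%N ->
       form_norm ip (u n - l) < e }.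

Lemma ReD (z w : R[i]) : complex.Re (z + w) = complex.Re z + complex.Re w.
Proof. by case: z; case: w. Qed.

Lemma ReN (z : R[i]) : complex.Re (- z) = - complex.Re z.
Proof. by case: z. Qed.

Lemma Re_conj (z : R[i]) : complex.Re z^* = complex.Re z.
Proof. by case: z. Qed.

Lemma conjM (z w : R[i]) : (z * w)^* = z^* * w^*.
Proof. exact: rmorphM. Qed.

Lemma conjD (z w : R[i]) : (z + w)^* = z^* + w^*.
Proof. exact: rmorphD. Qed.

Lemma conj_real (a : R) : (a%:C%C : R[i])^* = a%:C%C.
Proof. exact: conjc_real. Qed.

Lemma conj0 : (0 : R[i])^* = 0.
Proof. exact: rmorph0. Qed.

Lemma conjK (z : R[i]) : z^*^* = z.
Proof. exact: conjcK. Qed.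

Lemma Re_le_norm (z : R[i]) : complex.Re z <= normc z.
Proof.
case: z => a b /=; apply: (le_trans (ler_norm a)).
by rewrite -sqrtr_sqr ler_wsqrtr // lerDl sqr_ge0.
Qed.

Lemma normc_ge0 (z : R[i]) : 0 <= normc z.
Proof. by case: z => a b; exact: sqrtr_ge0. Qed.

Lemma normc_real (a : R) : normc a%:C%C = `|a|.
Proof. by rewrite /= expr0n addr0 sqrtr_sqr. Qed.

Lemma normc_sq (z : R[i]) : z * z^* = (normc z ^+ 2)%:C%C.
Proof. by rewrite -normCK normc_def rmorphXn /=; case: z. Qed.

Lemma normcD (z w : R[i]) : normc (z + w) <= normc z + normc w.
Proof. exact: le_normcD. Qed.

Lemma natSinv_lt (e : R) : 0 < e ->
  exists N, forall n, (N <= n)%N -> n.+1%:R^-1 < e.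
Proof.
move=> e0; have e1 : 0 <= e^-1 by rewrite invr_ge0 ltW.
exists (Num.bound e^-1) => n Nn; rewrite -[e]invrK ltf_pV2 ?posrE ?invr_gt0 //.
apply: (lt_le_trans (archi_boundP e1)).
by rewrite ler_nat (leq_trans Nn).
Qed.

Section OneSpace.
Variables (E : lmodType R[i]) (ip : E -> E -> R[i]).
Hypothesis hE : hilbert_form ip.
Local Notation nm := (form_norm ip).

Lemma form0l x : ip 0 x = 0.
Proof.
have := formP hE 1 0 0 x; rewrite scaler0 addr0 mul1r => h.
by apply: (addrI (ip 0 x)); rewrite addr0 -h.
Qed.

Lemma formDl x y z : ip (x + y) z = ip x z + ip y z.
Proof. by rewrite -[x in LHS]scale1r (formP hE) mul1r. Qed.

Lemma formZl a x z : ip (a *: x) z = a * ip x z.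
Proof. by rewrite -[_ *: _]addr0 (formP hE) form0l addr0. Qed.

Lemma formNl x z : ip (- x) z = - ip x z.
Proof. by rewrite -scaleN1r formZl mulN1r. Qed.

Lemma formBl x y z : ip (x - y) z = ip x z - ip y z.
Proof. by rewrite formDl formNl. Qed.

Lemma formDr x y z : ip z (x + y) = ip z x + ip z y.
Proof. by rewrite !(formC hE _ z) formDl rmorphD. Qed.

Lemma formZr a x z : ip z (a *: x) = a^* * ip z x.
Proof. by rewrite !(formC hE _ z) formZl rmorphM. Qed.

Lemma formNr x z : ip z (- x) = - ip z x.
Proof. by rewrite !(formC hE _ z) formNl rmorphN. Qed.

Lemma formBr x y z : ip z (x - y) = ip z x - ip z y.
Proof. by rewrite formDr formNr. Qed.

Lemma form0r x : ip x 0 = 0.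
Proof. by rewrite (formC hE) form0l rmorph0. Qed.

Lemma Re_formC x y : complex.Re (ip x y) = complex.Re (ip y x).
Proof. by rewrite (formC hE) Re_conj. Qed.

Lemma form_norm_ge0 x : 0 <= nm x. Proof. exact: sqrtr_ge0. Qed.

Lemma form_normE x : ip x x = (nm x ^+ 2)%:C%C.
Proof.
have := form_ge0 hE x; rewrite lecE /= => /andP[/eqP im0 re0].
by rewrite sqr_sqrtr //; case: (ip x x) im0 => a b /= ->.
Qed.

Lemma form_norm_sq x : nm x ^+ 2 = complex.Re (ip x x).
Proof. by rewrite form_normE. Qed.

Lemma form_norm_eq0 x : nm x = 0 -> x = 0.
Proof. by move=> h; apply: (form_eq0 hE); rewrite form_normE h expr0n. Qed.

Lemma form_norm0 : nm 0 = 0.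
Proof. by rewrite /form_norm form0l /= sqrtr0. Qed.

Lemma form_normZ a x : nm (a *: x) = normc a * nm x.
Proof.
apply/eqP; rewrite -(@eqrXn2 _ 2) ?form_norm_ge0 ?mulr_ge0 ?normc_ge0
  ?form_norm_ge0 //.
rewrite form_norm_sq formZl formZr form_normE mulrA normc_sq -rmorphM /=.
by rewrite exprMn.
Qed.

Lemma form_normN x : nm (- x) = nm x.
Proof. by rewrite /form_norm formNl formNr opprK. Qed.

Lemma form_normBC x y : nm (x - y) = nm (y - x).
Proof. by rewrite -opprB form_normN. Qed.

Lemma form_norm_sqD x y :
  nm (x + y) ^+ 2 = nm x ^+ 2 + nm y ^+ 2 + 2 * complex.Re (ip x y).
Proof.
rewrite !form_norm_sq formDl !formDr !ReD (Re_formC y x); ring.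
Qed.

Lemma form_norm_sqB x y :
  nm (x - y) ^+ 2 = nm x ^+ 2 + nm y ^+ 2 - 2 * complex.Re (ip x y).
Proof. by rewrite form_norm_sqD form_normN formNr ReN mulrN. Qed.

Lemma parallelogram x y :
  nm (x + y) ^+ 2 + nm (x - y) ^+ 2 = 2 * nm x ^+ 2 + 2 * nm y ^+ 2.
Proof. rewrite form_norm_sqD form_norm_sqB; ring. Qed.

(** Pythagoras for the component of [x] orthogonal to [y].  It gives both the
    Cauchy-Schwarz inequality (the left side is nonnegative) and the
    orthogonality of a nearest point (the left side is bounded below by the
    squared distance). *)
Lemma form_norm_sq_reduce x y : y != 0 ->
  nm (x - (ip x y / ip y y) *: y) ^+ 2 =
    nm x ^+ 2 - normc (ip x y) ^+ 2 / nm y ^+ 2.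
Proof.
move=> y0; have ny0 : nm y != 0 by apply: contra_neq y0; exact: form_norm_eq0.
have cE : ip x y / ip y y = ((nm y ^+ 2)^-1)%:C%C * ip x y.
  by rewrite form_normE -fmorphV mulrC.
rewrite form_norm_sqB form_normZ formZr exprMn cE conjM -mulrA.
rewrite [_^* * ip x y]mulrC normc_sq.
rewrite conj_real -rmorphM normcM /= expr0n /= addr0.
rewrite sqrtr_sqr ger0_norm ?invr_ge0 ?sqr_ge0 //.
field; exact: ny0.
Qed.

Lemma cauchy_schwarz x y : normc (ip x y) <= nm x * nm y.
Proof.
have [->|y0] := eqVneq y 0.
  by rewrite form0r normc0 form_norm0 mulr0.
have ny0 : nm y != 0 by apply: contra_neq y0; exact: form_norm_eq0.
have nygt : 0 < nm y by rewrite lt_def ny0 form_norm_ge0.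
rewrite -(@ler_pXn2r _ 2) ?nnegrE ?mulr_ge0 ?form_norm_ge0 ?normc_ge0 //.
rewrite exprMn -ler_pdivrMr ?exprn_gt0 // -subr_ge0 -form_norm_sq_reduce //.
exact: sqr_ge0.
Qed.

Lemma form_normD x y : nm (x + y) <= nm x + nm y.
Proof.
rewrite -(@ler_pXn2r _ 2) ?nnegrE ?addr_ge0 ?form_norm_ge0 // form_norm_sqD.
have := cauchy_schwarz x y; have := Re_le_norm (ip x y); nra.
Qed.

Lemma form_norm_triangle y x z : nm (x - z) <= nm (x - y) + nm (y - z).
Proof. by rewrite -[x - z](subrKA y); exact: form_normD. Qed.

Lemma form_norm_small x : (forall e : R, 0 < e -> nm x <= e) -> x = 0.
Proof.
move=> h; apply: form_norm_eq0; apply: le_anti; rewrite form_norm_ge0 andbT.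
by apply/ler_addgt0Pr => e e0; rewrite add0r; exact: h.
Qed.

Lemma normc_small (z : R[i]) : (forall e : R, 0 < e -> normc z <= e) -> z = 0.
Proof.
move=> h; apply: eq0_normc; apply: le_anti.
rewrite normc_ge0 andbT.
by apply/ler_addgt0Pr => e e0; rewrite add0r; exact: h.
Qed.

Definition adherent (S : set E) (x : E) :=
  forall e : R, 0 < e -> exists2 m, S m & nm (x - m) < e.

(** The consequence of density that makes adjoints single valued. *)
Definition total (S : set E) :=
  forall y, (forall x, S x -> ip x y = 0) -> y = 0.

Definition subspace (S : set E) :=
  S 0 /\ forall a x y, S x -> S y -> S (a *: x + y).

Lemma adherent_orth (S : set E) x y :
  adherent S x -> (forall m, S m -> ip m y = 0) -> ip x y = 0.
Proof.
move=> Sx Sy; apply: normc_small => e e0.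
have k0 : 0 < nm y + 1 by have := form_norm_ge0 y; lra.
have [m Sm xm] := Sx (e / (nm y + 1)) (divr_gt0 e0 k0).
rewrite -[ip x y]subr0 -(Sy m Sm) -formBl (le_trans (cauchy_schwarz _ _)) //.
rewrite ltr_pdivlMr // in xm; have := form_norm_ge0 y;
  have := form_norm_ge0 (x - m); nra.
Qed.

Lemma dense_total (S : set E) : (forall x, adherent S x) -> total S.
Proof.
by move=> dS y Sy; apply: (form_eq0 hE); exact: adherent_orth (dS y) Sy.
Qed.

End OneSpace.
End HilbertForms.

(** * Linear operators, projections, closed ranges and Riesz representation *)

Section LinearOps.
Variables (K : numFieldType) (U V : lmodType K) (T : operator U V).
Hypothesis linT : linear_op T.

Lemma linear_op_dom a x y : dom T x -> dom T y -> dom T (a *: x + y).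
Proof. by move=> Tx Ty; have [] := linT.2 a x y Tx Ty. Qed.

Lemma linear_opP a x y :
  dom T x -> dom T y -> T (a *: x + y) = a *: T x + T y.
Proof. by move=> Tx Ty; have [] := linT.2 a x y Tx Ty. Qed.

Lemma linear_op_domB x y : dom T x -> dom T y -> dom T (x - y).
Proof. by move=> Tx Ty; rewrite addrC -scaleN1r; exact: linear_op_dom. Qed.

Lemma linear_opB x y : dom T x -> dom T y -> T (x - y) = T x - T y.
Proof.
by move=> Tx Ty; rewrite addrC -scaleN1r linear_opP // scaleN1r addrC.
Qed.

Lemma linear_op0 : T 0 = 0.
Proof. by have := linear_opB linT.1 linT.1; rewrite !subrr. Qed.

End LinearOps.

Section HilbertTheory.
Context {R : realType}.
Variables (E : lmodType R[i]) (ip : E -> E -> R[i]).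
Hypothesis hE : hilbert_form ip.
Local Notation nm := (form_norm ip).

(** A minimizing sequence for the distance to [w] is Cauchy by the parallelogram
    identity, and its limit is the required point.  Each term is orthogonal to
    [M] up to an error given by its excess over the infimum, and this passes to
    the limit. *)
Lemma projection (M : set E) : subspace M ->
  (forall x, adherent ip M x -> M x) ->
  forall w, exists2 m, M m & forall u, M u -> ip (w - m) u = 0.
Proof.
move=> [M0 Mlin] Mcl w.
pose D := [set nm (w - m) ^+ 2 | m in M].
have hD : has_inf D.
  split; first by exists (nm (w - 0) ^+ 2); exists 0.
  by exists 0 => _ [m _ <-]; exact: sqr_ge0.
have dle m : M m -> inf D <= nm (w - m) ^+ 2.
  by move=> Mm; apply: ge_inf; [exact: hD.2 | exists m].
have /choice[f fP] (n : nat) :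
    exists m, M m /\ nm (w - m) ^+ 2 < inf D + n.+1%:R^-1.
  have n0 : 0 < (n.+1%:R^-1 : R) by rewrite invr_gt0.
  by have [_ [m Mm <-] hm] := inf_adherent n0 hD; exists m.
have fcauchy i j : nm (f i - f j) ^+ 2 <= 2 * i.+1%:R^-1 + 2 * j.+1%:R^-1.
  have [Mi hi] := fP i; have [Mj hj] := fP j.
  have := parallelogram hE (w - f j) (w - f i).
  have -> : w - f j - (w - f i) = f i - f j.
    by rewrite opprB addrC addrA subrK.
  have -> : w - f j + (w - f i) = 2 *: (w - (2^-1 *: f i + 2^-1 *: f j)).
    rewrite scalerBr scalerDr !scalerA mulfV ?pnatr_eq0 // !scale1r.
    by rewrite scaler_nat mulr2n opprD addrACA [- f i - f j]addrC.
  have Mij : M (2^-1 *: f i + 2^-1 *: f j).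
    by apply: (Mlin) => //; rewrite -[_ *: _]addr0; exact: Mlin.
  have := dle _ Mij; rewrite (form_normZ hE) exprMn.
  have -> : normc (2 : R[i]) = 2.
    by rewrite -(rmorph_nat (@real_complex_def R (Phant R))) normc_real
      normr_nat.
  move: hi hj; move: (i.+1%:R^-1) (j.+1%:R^-1) (inf D) => p q d; lra.
have [l lP] : exists l, forall e : R, 0 < e -> exists N, forall n, (N <= n)%N ->
    nm (f n - l) < e.
  apply: (form_complete hE) => e e0.
  have e2 : 0 < e ^+ 2 / 4 by rewrite divr_gt0 // exprn_gt0.
  have [N NP] := natSinv_lt e2; exists N => m n Nm Nn.
  rewrite -(@ltr_pXn2r _ 2) ?nnegrE ?form_norm_ge0 ?(ltW e0) //.
  apply: (le_lt_trans (fcauchy m n)).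
  have := NP _ Nm; have := NP _ Nn.
  by move: (m.+1%:R^-1) (n.+1%:R^-1) => p q; lra.
exists l.
  apply: Mcl => e e0; have [N NP] := lP _ e0.
  by exists (f N); [exact: (fP N).1 | rewrite (form_normBC hE); exact: NP].
move=> u Mu; have [->|u0] := eqVneq u 0; first exact: (form0r hE).
have nu0 : nm u != 0 by apply: contra_neq u0; exact: (form_norm_eq0 hE).
have nu : 0 < nm u by rewrite lt_def nu0 form_norm_ge0.
(* near-minimality along the line through f n in the direction u *)
have small n : normc (ip (w - f n) u) ^+ 2 < nm u ^+ 2 * n.+1%:R^-1.
  have [Mn hn] := fP n; rewrite mulrC -ltr_pdivrMr ?exprn_gt0 //.
  have := form_norm_sq_reduce hE (w - f n) u0; rewrite -addrA -opprD => h.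
  have := dle (f n + (ip (w - f n) u / ip u u) *: u).
  rewrite h => /(_ _); rewrite addrC => /(_ (Mlin _ _ _ Mu Mn)).
  by move: hn; move: (n.+1%:R^-1) (inf D) => p d; rewrite addrC; lra.
apply: normc_small => e e0.
have e1 : 0 < e / 2 / nm u by rewrite !divr_gt0.
have [N1 N1P] := lP _ e1.
have e2 : 0 < (e / 2 / nm u) ^+ 2 by rewrite exprn_gt0.
have [N2 N2P] := natSinv_lt e2.
pose n := maxn N1 N2.
have -> : ip (w - l) u = ip (w - f n) u + ip (f n - l) u.
  by rewrite -(formDl hE) subrKA.
apply: (le_trans (normcD _ _)); rewrite [leRHS](splitr e); apply: lerD.
  rewrite -(@ler_pXn2r _ 2) ?nnegrE ?normc_ge0 ?divr_ge0 ?(ltW e0) //.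
  apply: (le_trans (ltW (small n))).
  have := N2P n (leq_maxr _ _); rewrite [X in _ < X]exprMn exprVn.
  by rewrite ltr_pdivlMr ?exprn_gt0 // mulrC => /ltW.
apply: (le_trans (cauchy_schwarz hE _ _)).
by have := N1P n (leq_maxl _ _); rewrite ltr_pdivlMr // => /ltW.
Qed.

(** Adherence to the graph, spelled out in the two components so that no form
    on the product is needed. *)
Definition closed_graph (T : operator E E) := forall x w,
  (forall e : R, 0 < e ->
     exists2 x', dom T x' & nm (x - x') < e /\ nm (w - T x') < e) ->
  dom T x /\ T x = w.

(** Boundedness from below makes the preimages of a convergent sequence Cauchy,
    so the range is closed; being total, it is everything by [projection]. *)
Lemma closed_range_surj (T : operator E E) (c : R) :
  linear_op T -> closed_graph T -> 0 < c ->
  (forall x, dom T x -> c * nm x <= nm (T x)) ->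
  total ip [set T x | x in dom T] ->
  forall w, exists2 x, dom T x & T x = w.
Proof.
move=> linT clT c0 below tot w.
have sub : subspace [set T x | x in dom T].
  split; first by exists 0; [exact: linT.1 | exact: linear_op0].
  move=> a _ _ [x Tx <-] [y Ty <-]; exists (a *: x + y).
    exact: linear_op_dom.
  exact: linear_opP.
have cl v : adherent ip [set T x | x in dom T] v -> [set T x | x in dom T] v.
  move=> adv.
  have /choice[f fP] (n : nat) :
      exists x, dom T x /\ nm (v - T x) < n.+1%:R^-1.
    have n0 : 0 < (n.+1%:R^-1 : R) by rewrite invr_gt0.
    by have [_ [x Tx <-] hx] := adv _ n0; exists x.
  have [x xP] : exists l, forall e : R, 0 < e -> exists N, forall n, (N <= n)%N
    ->
      nm (f n - l) < e.
    apply: (form_complete hE) => e e0.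
    have e2 : 0 < c * e / 2 by rewrite divr_gt0 // mulr_gt0.
    have [N NP] := natSinv_lt e2; exists N => m n Nm Nn.
    have [Tm hm] := fP m; have [Tn hn] := fP n.
    rewrite -(ltr_pM2l c0).
    have := below _ (linear_op_domB linT Tm Tn); rewrite (linear_opB linT) //.
    have := form_norm_triangle hE v (T (f m)) (T (f n)).
    rewrite (form_normBC hE (T _) v); have := NP _ Nm; have := NP _ Nn.
    move: hm hn; move: (m.+1%:R^-1) (n.+1%:R^-1) => p q.
    by lra.
  suff [Tx Txv] : dom T x /\ T x = v by exists x.
  apply: clT => e e0.
  have [N1 N1P] := xP _ e0; have [N2 N2P] := natSinv_lt e0.
  have [Tn hn] := fP (maxn N1 N2); exists (f (maxn N1 N2)) => //; split.
    by rewrite (form_normBC hE); apply: N1P; exact: leq_maxl.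
  by apply: (lt_trans hn); apply: N2P; exact: leq_maxr.
have [_ [x Tx <-] h] := projection sub cl w.
exists x => //; apply/esym/eqP; rewrite -subr_eq0; apply/eqP.
by apply: tot => v /h h0; rewrite (formC hE) h0 conj0.
Qed.

(** When [f] is not zero, a vector [n] orthogonal to its closed kernel represents
    it after scaling, since [x - (f x / f n) *: n] lies in the kernel. *)
Lemma riesz (f : E -> R[i]) (M : R) : 0 <= M ->
  (forall a x y, f (a *: x + y) = a * f x + f y) ->
  (forall x, normc (f x) <= M * nm x) ->
  exists y, forall x, f x = ip x y.
Proof.
move=> M0 lin bd.
have f0 : f 0 = 0.
  by have := lin (-1) 0 0; rewrite scaler0 addr0 mulN1r addNr.
have [fz|/existsNP[x0 /eqP fx0]] := pselect (forall x, f x = 0).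
  by exists 0 => x; rewrite fz (form0r hE).
have fB x y : f (x - y) = f x - f y.
  by rewrite addrC -scaleN1r lin mulN1r addrC.
have sub : subspace [set x | f x = 0].
  by split => //= a x y fx fy; rewrite lin fx fy mulr0 addr0.
have cl x : adherent ip [set x | f x = 0] x -> f x = 0.
  move=> adx; apply: normc_small => e e0.
  have k0 : 0 < M + 1 by lra.
  have [m /= fm xm] := adx _ (divr_gt0 e0 k0).
  rewrite -[f x]subr0 -fm -fB; apply: (le_trans (bd _)).
  by rewrite ltr_pdivlMr // in xm; have := form_norm_ge0 ip (x - m); nra.
have [p /= fp orth] := projection sub cl x0.
set n := x0 - p in orth.
have fn : f n != 0 by rewrite fB fp subr0.
have n0 : ip n n != 0.
  by apply: contra_neq fn => /(form_eq0 hE) ->.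
exists ((f n / ip n n)^* *: n) => x.
rewrite (formZr hE) conjK.
have /orth h : f (x - (f x / f n) *: n) = 0.
  by rewrite fB -[_ *: n]addr0 lin f0 addr0 mulfVK // subrr.
have : ip (x - (f x / f n) *: n) n = 0 by rewrite (formC hE) h conj0.
rewrite (formBl hE) (formZl hE) => /eqP; rewrite subr_eq0 => /eqP ->.
by field; rewrite fn n0.
Qed.

End HilbertTheory.

(** * Boundedness of everywhere defined operators with a formal adjoint *)

Section UniformBoundedness.
Context {R : realType}.
Variables (E : lmodType R[i]) (ip : E -> E -> R[i]).
Hypothesis hE : hilbert_form ip.
Local Notation nm := (form_norm ip).
Variables (K K' : E -> E) (D : set E).
Hypothesis linK : forall a x y, K (a *: x + y) = a *: K x + K y.
Hypothesis dD : forall x, adherent ip D x.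
Hypothesis adjK : forall u w, D w -> ip (K u) w = ip u (K' w).

Let KD x y : K (x + y) = K x + K y.
Proof. by rewrite -[x in LHS]scale1r linK scale1r. Qed.

Let K0 : K 0 = 0.
Proof. by apply: (addIr (K 0)); rewrite -KD !add0r. Qed.

Let KZ a x : K (a *: x) = a *: K x.
Proof. by rewrite -[X in K X]addr0 linK K0 addr0. Qed.

(** The inequality [k <= nm (K u)] is tested against a single vector [w] of [D]
    near [K x]; since [ip (K u) w = ip u (K' w)] is continuous in [u], it
    persists on a ball although [K] is not known to be continuous. *)
Lemma large_near (k : R) x r : 0 <= k -> 0 < r -> k + 2 < nm (K x) ->
  exists r', [/\ 0 < r', r' <= r &
    forall u, nm (u - x) <= r' -> k <= nm (K u)].
Proof.
move=> k0 r0 big.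
have h : 0 < 2^-1 :> R by rewrite invr_gt0.
have [w Dw xw] := dD (K x) h.
have nw : k + 1 + 2^-1 < nm w.
  have := form_normD hE (K x - w) w; rewrite subrK; lra.
have nw0 : 0 < nm w by lra.
have ge : (k + 1) * nm w <= normc (ip (K x) w).
  have := normcD (ip (K x) w) (ip (w - K x) w).
  rewrite -(formDl hE) addrC subrK form_normE // normc_real ger0_norm ?sqr_ge0
    //.
  have := cauchy_schwarz hE (w - K x) w; rewrite (form_normBC hE w).
  by move: (form_norm_ge0 ip (K x - w)) => ?;  nra.
have d0 : 0 < nm (K' w) + 1 by rewrite ltr_wpDl // form_norm_ge0.
exists (Num.min r (nm w / (nm (K' w) + 1))).
split; first by rewrite lt_min r0 divr_gt0.
  by rewrite ge_min lexx.
move=> u; rewrite le_min ler_pdivlMr // => /andP[_ ux].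
rewrite -(ler_pM2r nw0).
have split_x : ip (K x) w = ip (K u) w + ip (x - u) (K' w).
  by rewrite -adjK // -(formDl hE) -KD addrC subrK.
have := normcD (ip (K u) w) (ip (x - u) (K' w)); rewrite -split_x.
have := cauchy_schwarz hE (x - u) (K' w); rewrite (form_normBC hE x).
have := cauchy_schwarz hE (K u) w.
by have := form_norm_ge0 ip (u - x); nra.
Qed.

(** A Hellinger-Toeplitz theorem.  If [K] were unbounded, every ball would
    contain a smaller ball on which [nm (K u)] is at least [n]; the common point
    of a nested sequence of such balls would be mapped to a vector of infinite
    norm. *)
Lemma formal_adjoint_bounded :
  exists2 M : R, 0 <= M & forall u, nm (K u) <= M * nm u.
Proof.
apply: contrapT => unb.
have big (M : R) : 0 <= M -> exists u, M * nm u < nm (K u).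
  move=> M0; apply: contrapT => nb; apply: unb; exists M => // u.
  by rewrite leNgt; apply/negP => lt; apply: nb; exists u.
have step (p : E * R) (n : nat) : exists p' : E * R, 0 < p.2 ->
    [/\ 0 < p'.2, p'.2 <= p.2 / 2, nm (p'.1 - p.1) <= p.2 / 2 &
     forall u, nm (u - p'.1) <= p'.2 -> n%:R <= nm (K u)].
  case: p => x r /=; have [r0|] := boolP (0 < r); last by exists (x, r).
  suff [x' xx' Kx'] : exists2 x', nm (x' - x) <= r / 2 & n%:R + 2 < nm (K x').
    have r2 : 0 < r / 2 by rewrite divr_gt0.
    have [r' [? ? ?]] := large_near (ler0n _ n) r2 Kx'.
    by exists (x', r').
  have nn0 : 0 <= (n%:R : R) by rewrite ler0n.
  (* u rescaled to length r / 2 has image longer than 2 * (n + 2), so x or x + v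
     has image longer than n + 2 *)
  have M0 : 0 <= 2 * (n%:R + 2) / (r / 2).
    by rewrite divr_ge0 ?divr_ge0 ?mulr_ge0 ?addr_ge0 ?(ltW r0).
  have [u hu] := big _ M0.
  have nu0 : nm u != 0.
    apply/eqP => /(form_norm_eq0 hE) u0; move: hu.
    by rewrite u0 K0 (form_norm0 hE) mulr0 ltxx.
  have nu : 0 < nm u by rewrite lt_def nu0 form_norm_ge0.
  pose v := (r / 2 / nm u)%:C%C *: u.
  have s0 : 0 < r / 2 / nm u by rewrite !divr_gt0.
  have nv : nm v = r / 2.
    by rewrite (form_normZ hE) normc_real gtr0_norm // mulfVK.
  have Kv : 2 * (n%:R + 2) < nm (K v).
    rewrite KZ (form_normZ hE) normc_real gtr0_norm //.
    rewrite -(ltr_pM2l s0) in hu; apply: le_lt_trans hu.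
    rewrite le_eqVlt; apply/orP; left; apply/eqP; field.
    by rewrite nu0 gt_eqF.
  have [?|le] := ltP (n%:R + 2) (nm (K x)).
    by exists x => //; rewrite subrr (form_norm0 hE) divr_ge0 // ltW.
  exists (x + v); first by rewrite addrC addKr nv.
  have := form_normD hE (K (x + v)) (- K x);
    rewrite (form_normN hE) KD addrC addKr.
  by move: le Kv; move: (n%:R : R) => k; lra.
have /choice[f fP] (q : (E * R) * nat) := step q.1 q.2.
pose s := fix s n := if n is m.+1 then f (s m, n) else (0 : E, 1 : R).
have s_pos n : 0 < (s n).2.
  by elim: n => [|n IH] /=; [exact: ltr01 | have [] := fP (s n, n.+1) IH].
have sP n := fP (s n, n.+1) (s_pos n).
have s_nest n m : nm ((s (m + n)%N).1 - (s n).1) + (s (m + n)%N).2 <= (s n).2.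
  elim: m => [|m IH]; first by rewrite add0n subrr (form_norm0 hE) add0r.
  have [_ /= h1 h2 _] := sP (m + n)%N; rewrite -/s in h1 h2.
  have := form_norm_triangle hE (s (m + n)%N).1 (s (m.+1 + n)%N).1 (s n).1.
  by rewrite addSn /=; lra.
have s_small n : (s n).2 <= n.+1%:R^-1.
  elim: n => [|n IH]; first by rewrite invr1.
  have [_ /= h1 _ _] := sP n; apply: (le_trans h1).
  apply: (@le_trans _ _ (n.+1%:R^-1 / 2)); first by rewrite ler_pM2r ?invr_gt0.
  rewrite -invfM lef_pV2 ?posrE ?mulr_gt0 // -natrM ler_nat.
  by rewrite muln2 -addnn addSn ltnS leq_addl.
have s_dist n m : (n <= m)%N -> nm ((s m).1 - (s n).1) <= (s n).2.
  by move=> /subnK <-; have := s_nest n (m - n)%N;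
    have := s_pos (m - n + n)%N; lra.
have [l lP] : exists l, forall e : R, 0 < e -> exists N, forall n, (N <= n)%N ->
    nm ((s n).1 - l) < e.
  apply: (form_complete hE) => e e0.
  have [N NP] := natSinv_lt (divr_gt0 e0 (ltr0n R 2)); exists N => m n Nm Nn.
  have := form_norm_triangle hE (s N).1 (s m).1 (s n).1.
  have := s_dist _ _ Nm; have := s_dist _ _ Nn;
    rewrite (form_normBC hE (s n).1).
  have := le_lt_trans (s_small N) (NP _ (leqnn N)); lra.
have l_in n : nm (l - (s n).1) <= (s n).2.
  apply/ler_addgt0Pr => e e0; have [N NP] := lP e e0.
  have := form_norm_triangle hE (s (maxn N n)).1 l (s n).1.
  have := NP _ (leq_maxl N n); rewrite (form_normBC hE _ l).
  by have := s_dist _ _ (leq_maxr N n); lra.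
have large n : n.+1%:R <= nm (K l).
  by have [_ _ _] := sP n; apply; exact: (l_in n.+1).
have := archi_boundP (form_norm_ge0 ip (K l)); rewrite ltNge => /negP; apply.
by apply: le_trans (large _); rewrite ler_nat.
Qed.

End UniformBoundedness.

(** * Self-adjoint operators and the Kato-Rellich theorem *)

Section KatoRellich.
Context {R : realType}.
Variables (E : lmodType R[i]) (ip : E -> E -> R[i]).
Hypothesis hE : hilbert_form ip.
Local Notation nm := (form_norm ip).

Definition symmetric_op (T : operator E E) :=
  forall x y, dom T x -> dom T y -> ip (T x) y = ip x (T y).

(** Equality with the adjoint, without the adjoint: [sa_symmetric] says that [T]
    is contained in its adjoint, [sa_maximal] that the adjoint has no larger
    domain, and [sa_total] that the adjoint is single valued. *)
Record self_adjoint_op (T : operator E E) : Prop := {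
  sa_linear : linear_op T;
  sa_symmetric : symmetric_op T;
  sa_total : total ip (dom T);
  sa_maximal : forall y z, adjoint_rel ip T y z -> dom T y }.

(** The domain is that of [T]: the operator [V] is a perturbation whose domain
    contains it. *)
Definition add_op (T V : operator E E) : operator E E :=
  Operator (dom T) (fun x => T x + V x).

Definition scale_op (c : R[i]) : operator E E := Operator setT ( *:%R c).

Lemma add_op_linear T V : linear_op T -> linear_op V -> dom T `<=` dom V ->
  linear_op (add_op T V).
Proof.
move=> linT linV sub; split=> [|a x y Tx Ty /=]; first exact: linT.1.
split; first exact: linear_op_dom.
rewrite (linear_opP linT) // (linear_opP linV); [|exact: sub | exact: sub].
by rewrite scalerDr addrACA.
Qed.

Lemma scale_op_linear c : linear_op (scale_op c).
Proof. by split=> // a x y _ _; split=> //=;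
  rewrite scalerDr !scalerA mulrC. Qed.

Lemma adjoint_rel_unique T y z z' : total ip (dom T) ->
  adjoint_rel ip T y z -> adjoint_rel ip T y z' -> z = z'.
Proof.
move=> tot h h'; apply/eqP; rewrite -subr_eq0; apply/eqP; apply: tot => x Tx.
by rewrite (formBr hE) -h // -h' // subrr.
Qed.

Lemma sa_adjoint_rel T y z :
  self_adjoint_op T -> adjoint_rel ip T y z -> dom T y /\ T y = z.
Proof.
move=> saT h; have Ty := sa_maximal saT h; split=> //.
apply: (adjoint_rel_unique (sa_total saT)) h => x Tx.
exact: sa_symmetric.
Qed.

(** Adjoint relations are closed, so the closure of the graph of a symmetric
    operator stays inside the graph of its adjoint. *)
Lemma symmetric_limit T x w : symmetric_op T ->
  (forall e : R, 0 < e ->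
     exists2 x', dom T x' & nm (x - x') < e /\ nm (w - T x') < e) ->
  adjoint_rel ip T x w.
Proof.
move=> sym lim u Tu; apply/eqP; rewrite -subr_eq0; apply/eqP.
apply: normc_small => e e0.
have k0 : 0 < nm (T u) + nm u + 1.
  by have := form_norm_ge0 ip (T u); have := form_norm_ge0 ip u; lra.
have [x' Tx' [xx' wx']] := lim _ (divr_gt0 e0 k0).
have -> : ip (T u) x - ip u w = ip (T u) (x - x') - ip u (w - T x').
  by rewrite !(formBr hE) (sym u x') //; ring.
apply: (le_trans (normcD _ _)).
have -> : normc (- ip u (w - T x')) = normc (ip u (w - T x')).
  by rewrite -mulN1r normcM -(rmorphN1 (@real_complex_def R (Phant R)))
    normc_real normrN1 mul1r.
have := cauchy_schwarz hE (T u) (x - x').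
have := cauchy_schwarz hE u (w - T x').
rewrite ltr_pdivlMr // in xx'; rewrite ltr_pdivlMr // in wx'.
move: (form_norm_ge0 ip (T u)) (form_norm_ge0 ip u) (form_norm_ge0 ip (x - x')).
move: (form_norm_ge0 ip (w - T x')) xx' wx'.
move: (nm (T u)) (nm u) (nm (x - x')) (nm (w - T x')) => a b c d.
move=> d0 h1 h2 a0 b0 c0.
have [cd|/ltW dc] := leP c d; nra.
Qed.

Lemma symmetric_real T x : symmetric_op T -> dom T x ->
  complex.Im (ip (T x) x) = 0.
Proof.
move=> sym Tx; have := formC hE (T x) x; rewrite -(sym x x) //.
by case: (ip (T x) x) => a b /= [] h; lra.
Qed.

(** The cross term vanishes because [ip (T x) x] is real while the scalar is
    purely imaginary. *)
Lemma form_norm_sq_shift T x (mu : R) : symmetric_op T -> dom T x ->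
  nm (T x + (0 +i* mu)%C *: x) ^+ 2 = nm (T x) ^+ 2 + mu ^+ 2 * nm x ^+ 2.
Proof.
move=> sym Tx; rewrite (form_norm_sqD hE) (form_normZ hE) (formZr hE) exprMn.
have := symmetric_real sym Tx; case: (ip (T x) x) => a b /= ->.
rewrite expr0n add0r sqrtr_sqr real_normK ?num_real //; ring.
Qed.

Lemma shift_bounded_below T x (mu : R) : symmetric_op T -> dom T x ->
  `|mu| * nm x <= nm (T x + (0 +i* mu)%C *: x).
Proof.
move=> sym Tx; rewrite -(@ler_pXn2r _ 2) ?nnegrE ?mulr_ge0 ?form_norm_ge0 //.
by rewrite (form_norm_sq_shift _ sym Tx) exprMn real_normK ?num_real // lerDr
  sqr_ge0.
Qed.

Lemma imag_conj (mu : R) : (0 +i* mu)%C^* = - (0 +i* mu)%C.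
Proof. by apply/eqP; rewrite eq_complex /= oppr0 !eqxx. Qed.

(** The range of the shifted operator is closed, and a vector orthogonal to it is
    an eigenvector of [T] for a purely imaginary eigenvalue, which
    [form_norm_sq_shift] excludes. *)
Lemma sa_shift_surj T (mu : R) : self_adjoint_op T -> mu != 0 ->
  forall w, exists2 x, dom T x & T x + (0 +i* mu)%C *: x = w.
Proof.
move=> saT mu0; set c := (0 +i* mu)%C.
have [linT sym tot _] := saT.
pose L := add_op T (scale_op c).
have linL : linear_op L by apply: add_op_linear => //; exact: scale_op_linear.
have mugt : 0 < `|mu| by rewrite normr_gt0.
have nc : normc c = `|mu| by rewrite /= expr0n add0r sqrtr_sqr.
have clL : closed_graph ip L.
  move=> x w lim.
  have [Tx Txw] : dom T x /\ T x = w - c *: x.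
    apply: sa_adjoint_rel => //; apply: symmetric_limit => // e e0.
    have k0 : 0 < `|mu| + 1 by lra.
    have [x' Tx' [xx' wx']] := lim _ (divr_gt0 e0 k0); exists x' => //.
    rewrite !ltr_pdivlMr // in xx' wx'.
    have := form_norm_ge0 ip (x - x');
      have := form_norm_ge0 ip (w - L x') => ge1 ge2.
    split; first by nra.
    have -> : w - c *: x - T x' = (w - L x') + c *: (x' - x).
      by rewrite /= scalerBr opprD addrA addrA subrK addrAC.
    apply: (le_lt_trans (form_normD hE _ _));
      rewrite (form_normZ hE) nc (form_normBC hE x').
    move: ge1 ge2 xx' wx'.
    move: (nm (w - L x')) (nm (x - x')) `|mu| mugt => a b m m0 *.
    have [ab|/ltW ba] := leP a b; nra.
  by split=> //=; rewrite Txw subrK.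
have below x : dom L x -> `|mu| * nm x <= nm (L x).
  by move=> Tx; exact: (shift_bounded_below mu sym Tx).
apply: (closed_range_surj hE linL clL mugt below) => y hy.
have [Ty Tyc] : dom T y /\ T y = c *: y.
  apply: sa_adjoint_rel => // x Tx.
  have := hy (L x); rewrite /= (formDl hE) (formZl hE) (formZr hE) imag_conj.
  by rewrite mulNr => h; apply/eqP; rewrite -addr_eq0; apply/eqP/h; exists x.
have := form_norm_sq_shift (- mu) sym Ty; rewrite Tyc -scalerDl.
have -> : c + (0 +i* (- mu))%C = 0.
  by apply/eqP; rewrite eq_complex /= addr0 subrr !eqxx.
rewrite scale0r (form_norm0 hE) expr0n sqrrN => h.
have h1 : 0 <= nm (c *: y) ^+ 2 by exact: sqr_ge0.
have h2 : 0 <= mu ^+ 2 * nm y ^+ 2 by rewrite mulr_ge0 ?sqr_ge0.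
have /eqP : mu ^+ 2 * nm y ^+ 2 = 0 by rewrite /= in h; lra.
by rewrite mulf_eq0 !sqrf_eq0 (negbTE mu0) => /eqP; exact: form_norm_eq0.
Qed.

(** No series is summed: [id + K] is bounded below, and it is coercive enough for
    its range to have no orthogonal vector, so [closed_range_surj] applies. *)
Lemma id_add_contraction_surj (K : E -> E) :
  (forall a x y, K (a *: x + y) = a *: K x + K y) ->
  (forall x, nm (K x) <= 2^-1 * nm x) ->
  forall w, exists x, x + K x = w.
Proof.
move=> linK small.
pose L : operator E E := Operator setT (fun x => x + K x).
have linL : linear_op L.
  by split=> // a x y _ _; split=> //=; rewrite linK scalerDr addrACA.
have below x : dom L x -> 2^-1 * nm x <= nm (L x).
  move=> _ /=; have := form_normD hE (x + K x) (- K x).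
  by rewrite addrK (form_normN hE); have := small x; lra.
have clL : closed_graph ip L.
  move=> x w lim; split=> //; apply/esym/eqP; rewrite -subr_eq0; apply/eqP.
  apply: (form_norm_small hE) => e e0.
  have e4 : 0 < e / 4 by rewrite divr_gt0.
  have [x' _ [xx' wx']] := lim _ e4.
  have := form_norm_triangle hE (L x') w (L x); rewrite -(linear_opB linL) //= .
  have := form_normD hE (x' - x) (K (x' - x)); have := small (x' - x).
  by rewrite (form_normBC hE x') /= in wx' *;
    have := form_norm_ge0 ip (x - x'); lra.
have h0 : 0 < 2^-1 :> R by rewrite invr_gt0.
have tot : total ip [set L x | x in dom L].
  move=> y /(_ (L y)) /= h; apply: (form_norm_eq0 hE).
  have : ip (y + K y) y = 0 by apply: h; exists y.
  rewrite (formDl hE) (form_normE hE) => /(congr1 (@complex.Re R)).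
  rewrite ReD /= => h1.
  have := cauchy_schwarz hE (- K y) y; rewrite (formNl hE) (form_normN hE).
  have := Re_le_norm (- ip (K y) y); rewrite ReN.
  by have := small y; have := form_norm_ge0 ip y; nra.
by move=> w; have [x _ <-] := closed_range_surj hE linL clL h0 below tot w;
  exists x.
Qed.

(** With [G] the inverse of [T + i mu], the operator [T + V + i mu] factors as
    [(id + V G) (T + i mu)], and [V G] has norm at most one half. *)
Lemma perturbed_shift_surj T V (mu : R) : self_adjoint_op T -> mu != 0 ->
  linear_op V -> dom T `<=` dom V ->
  (forall x, dom T x -> nm (V x) <= 2^-1 * nm (T x + (0 +i* mu)%C *: x)) ->
  forall w, exists2 x, dom T x & T x + V x + (0 +i* mu)%C *: x = w.
Proof.
move=> saT mu0 linV sub bd w; have [linT sym tot _] := saT.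
have /choice[G GP] u :
    exists x, dom T x /\ T x + (0 +i* mu)%C *: x = u.
  by have [x Tx xu] := sa_shift_surj saT mu0 u; exists x.
pose L := add_op T (scale_op (0 +i* mu)%C).
have linL : linear_op L by apply: add_op_linear => //; exact: scale_op_linear.
have inj x y : dom T x -> dom T y -> L x = L y -> x = y.
  move=> Tx Ty xy; apply/eqP; rewrite -subr_eq0; apply/eqP;
    apply: (form_norm_eq0 hE).
  have := shift_bounded_below mu sym (linear_op_domB linT Tx Ty).
  have := linear_opB linL Tx Ty; rewrite xy subrr /= => ->.
  have mugt : 0 < `|mu| by rewrite normr_gt0.
  by rewrite (form_norm0 hE); have := form_norm_ge0 ip (x - y); nra.
have linG a x y : G (a *: x + y) = a *: G x + G y.
  apply: inj; first exact: (GP _).1.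
    exact: (linear_op_dom linT a (GP x).1 (GP y).1).
  rewrite (linear_opP linL a (GP x).1 (GP y).1).
  by rewrite /L /= !(GP _).2.
have [|u|u uw] := @id_add_contraction_surj (fun u => V (G u)) _ _ w.
- move=> a x y; rewrite linG (linear_opP linV) //; apply: sub; exact: (GP _).1.
- by rewrite -{2}(GP u).2; apply: bd; exact: (GP u).1.
exists (G u); first exact: (GP u).1.
by rewrite -uw -[X in _ = X + _](GP u).2 addrAC.
Qed.

(** For [mu] large, [V] is at most half of [T + i mu] and of [T - i mu] by
    [form_norm_sq_shift], so that [T + V + i mu] and [T + V - i mu] are onto. 
      If
    [y] is in the domain of the adjoint, surjectivity of the second yields [x]
      in
    the domain such that [y - x] is orthogonal to the range of the first, whence
    [y = x]. *)
Theorem kato_rellich T V (b : R) : self_adjoint_op T ->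
  linear_op V -> dom T `<=` dom V ->
  (forall x y, dom T x -> dom T y -> ip (V x) y = ip x (V y)) ->
  (forall x, dom T x ->
     nm (V x) ^+ 2 <= 4^-1 * nm (T x) ^+ 2 + b * nm x ^+ 2) ->
  self_adjoint_op (add_op T V).
Proof.
move=> saT linV sub symV bd; have [linT sym tot _] := saT.
have symTV : symmetric_op (add_op T V).
  by move=> x y Tx Ty /=; rewrite (formDl hE) (formDr hE) sym // symV.
split=> //; first exact: add_op_linear.
move=> y z yz.
(* the shifted square has coefficient mu ^+ 2 on nm x ^+ 2, and b must stay
   below a quarter of it *)
have [mu mugt mub] : exists2 mu : R, 0 < mu & 4 * b <= mu ^+ 2.
  exists (Num.sqrt `|4 * b| + 1); first by rewrite ltr_wpDl ?sqrtr_ge0.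
  have := sqr_sqrtr (normr_ge0 (4 * b)); have := ler_norm (4 * b).
  by have := sqrtr_ge0 `|4 * b|; nra.
have half (nu : R) : nu ^+ 2 = mu ^+ 2 -> forall x, dom T x ->
    nm (V x) <= 2^-1 * nm (T x + (0 +i* nu)%C *: x).
  move=> nu2 x Tx.
  rewrite -(@ler_pXn2r _ 2) ?nnegrE ?mulr_ge0 ?invr_ge0 ?form_norm_ge0 //.
  rewrite exprMn (form_norm_sq_shift _ sym Tx) nu2.
  have := bd x Tx; have := sqr_ge0 (nm x).
  by move: (nm x ^+ 2) (nm (T x) ^+ 2) (nm (V x) ^+ 2) => p q r *; nra.
have mu0 : mu != 0 by rewrite gt_eqF.
have nmu0 : - mu != 0 by rewrite oppr_eq0.
have surj := perturbed_shift_surj saT mu0 linV sub (half mu erefl).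
have [x Tx xz] := perturbed_shift_surj saT nmu0 linV sub
  (half (- mu) (sqrrN mu)) (z + (0 +i* (- mu))%C *: y).
suff -> : y = x by [].
apply/eqP; rewrite -subr_eq0; apply/eqP; apply: (form_eq0 hE).
have [u Tu uE] := surj (y - x).
have hx := symTV u x Tu Tx; have hy := yz u Tu.
rewrite /= in hx hy.
rewrite -{1}uE (formBr hE) !(formDl hE _ (_ *: u)) hx hy.
have -> : T x + V x = z + (0 +i* (- mu))%C *: y - (0 +i* (- mu))%C *: x.
  by rewrite -xz addrK.
rewrite !(formBr hE) !(formDr hE) !(formZr hE) (formZl hE) !imag_conj.
have -> : (0 +i* (- mu))%C = - (0 +i* mu)%C.
  by apply/eqP; rewrite eq_complex /= oppr0 !eqxx.
by rewrite !(formZl hE); ring.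
Qed.

End KatoRellich.

(** * Resolvents, adjoints and block operators *)

Section Resolvents.
Context {R : realType}.
Variables (E : lmodType R[i]) (ip : E -> E -> R[i]).
Hypothesis hE : hilbert_form ip.
Local Notation nm := (form_norm ip).

(** Membership in the resolvent set, with real norms and with injectivity left to
    the bound. *)
Definition resolvent_point (T : operator E E) (lam : R[i]) :=
  (forall w, exists2 x, dom T x & T x - lam *: x = w) /\
  exists2 M : R, 0 <= M &
    forall x, dom T x -> nm x <= M * nm (T x - lam *: x).

(** Two operators that are the adjoints of each other.  The symmetry of this notion
    in [A1] and [A2] is what lets one argument serve both cases of the theorem.
      *)
Record dual_pair (A1 A2 : operator E E) : Prop := {
  dual_linear1 : linear_op A1;
  dual_linear2 : linear_op A2;
  dual_total1 : total ip (dom A1);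
  dual_total2 : total ip (dom A2);
  dual_formal : forall x y, dom A1 x -> dom A2 y -> ip (A1 x) y = ip x (A2 y);
  dual_maximal2 : forall y z, adjoint_rel ip A1 y z -> dom A2 y;
  dual_maximal1 : forall y z, adjoint_rel ip A2 y z -> dom A1 y }.

Lemma dual_pairC A1 A2 : dual_pair A1 A2 -> dual_pair A2 A1.
Proof.
move=> [l1 l2 t1 t2 sym m2 m1]; split=> // x y A2x A1y.
by rewrite (formC hE) -sym // -(formC hE).
Qed.

Section Resolvent.
Variables (T : operator E E) (lam : R[i]).
Hypothesis linT : linear_op T.
Hypothesis resT : resolvent_point T lam.

Lemma resolvent_exists : exists G : E -> E,
  [/\ forall u, dom T (G u) /\ T (G u) - lam *: G u = u,
      forall x, dom T x -> G (T x - lam *: x) = x,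
      forall a x y, G (a *: x + y) = a *: G x + G y &
      exists2 M : R, 0 <= M & forall u, nm (G u) <= M * nm u].
Proof.
have [surj [M M0 below]] := resT.
have /choice[G GP] u : exists x, dom T x /\ T x - lam *: x = u.
  by have [x Tx xu] := surj u; exists x.
have inj x y : dom T x -> dom T y ->
    T x - lam *: x = T y - lam *: y -> x = y.
  move=> Tx Ty xy; apply/eqP; rewrite -subr_eq0; apply/eqP;
    apply: (form_norm_eq0 hE).
  have := below _ (linear_op_domB linT Tx Ty).
  have -> : T (x - y) - lam *: (x - y) = 0.
    rewrite (linear_opB linT) // scalerBr opprD addrACA -opprD xy.
    exact: subrr.
  by rewrite (form_norm0 hE) mulr0 => ?; apply: le_anti;
    rewrite form_norm_ge0 andbT.
exists G; split=> //.
- by move=> x Tx; apply: inj => //; [exact: (GP _).1 | exact: (GP _).2].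
- move=> a x y; apply: inj; first exact: (GP _).1.
    exact: (linear_op_dom linT a (GP x).1 (GP y).1).
  rewrite (GP _).2 (linear_opP linT a (GP x).1 (GP y).1).
  rewrite -{1}(GP x).2 -{1}(GP y).2 scalerBr scalerDr opprD addrACA !scalerA.
  by rewrite [a * lam]mulrC.
by exists M => // u; rewrite -{2}(GP u).2; apply: below; exact: (GP u).1.
Qed.

Lemma resolvent_adjoint (G : E -> E) (M : R) : 0 <= M ->
  (forall a x y, G (a *: x + y) = a *: G x + G y) ->
  (forall u, nm (G u) <= M * nm u) ->
  forall v, exists y, forall u, ip (G u) v = ip u y.
Proof.
move=> M0 linG bd v; apply: (@riesz _ _ _ hE _ (M * nm v)).
- by rewrite mulr_ge0 ?form_norm_ge0.
- by move=> a x y; rewrite linG (formP hE).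
move=> x; apply: (le_trans (cauchy_schwarz hE _ _)).
by rewrite mulrAC; apply: ler_wpM2r; [exact: form_norm_ge0 | exact: bd].
Qed.

(** A concrete closed graph theorem: with [G] a resolvent of [T], the operator
    [S G] is everywhere defined and [w |-> G* (S w)] is its formal adjoint on
    [dom S], so [S G] is bounded, and [S x = S G (T x - lam *: x)]. *)
Lemma symmetric_rel_bounded (S : operator E E) :
  linear_op S -> (forall x, adherent ip (dom S) x) -> symmetric_op ip S ->
  dom T `<=` dom S ->
  exists a b : R, [/\ 0 <= a, 0 <= b &
    forall x, dom T x -> nm (S x) <= a * nm (T x) + b * nm x].
Proof.
move=> linS dS symS sub.
have [G [GP GT linG [M M0 bd]]] := resolvent_exists.
have /choice[K' K'P] w := resolvent_adjoint M0 linG bd (S w).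
have SG u : dom S (G u) by apply: sub; exact: (GP u).1.
have linK a x y : S (G (a *: x + y)) = a *: S (G x) + S (G y).
  by rewrite linG (linear_opP linS).
have adjK u w : dom S w -> ip (S (G u)) w = ip u (K' w).
  by move=> Sw; rewrite symS.
have [N N0 hN] :=
  @formal_adjoint_bounded _ _ _ hE (fun u => S (G u)) _ _ linK dS adjK.
exists N, (N * normc lam); split; rewrite ?mulr_ge0 ?normc_ge0 //.
move=> x Tx; have := hN (T x - lam *: x); rewrite /= GT // => /le_trans; apply.
rewrite -mulrA -mulrDr -(form_normZ hE) -(form_normN hE (lam *: x)).
by apply: ler_wpM2l => //; exact: form_normD.
Qed.

Hypothesis totT : total ip (dom T).
Local Notation Ta := (adjoint ip T).

Lemma adjointP y : dom Ta y -> adjoint_rel ip T y (Ta y).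
Proof. by move=> [z yz]; exact: (xgetPex 0 (ex_intro _ z yz)). Qed.

Lemma adjointE y z : adjoint_rel ip T y z -> dom Ta y /\ Ta y = z.
Proof.
move=> yz; have Ty : dom Ta y by exists z.
by split=> //; exact: (adjoint_rel_unique hE totT (adjointP Ty) yz).
Qed.

Lemma adjoint_linear : linear_op Ta.
Proof.
split; first by exists 0 => x _; rewrite !(form0r hE).
move=> a x y Tx Ty; apply: adjointE => u Tu.
by rewrite !(formDr hE) !(formZr hE) (adjointP Tx) // (adjointP Ty).
Qed.

Lemma adjoint_shift x y : dom T x -> dom Ta y ->
  ip (T x - lam *: x) y = ip x (Ta y - lam^* *: y).
Proof.
move=> Tx Ty; rewrite (formBl hE) (formBr hE) (adjointP Ty) //.
by rewrite (formZl hE) (formZr hE) conjK.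
Qed.

(** The solution of [Ta y - lam^* *: y = v] represents the bounded functional
    [u |-> ip (G u) v], where [G] is the resolvent of [T] at [lam]. *)
Lemma adjoint_resolvent_point : resolvent_point Ta lam^*.
Proof.
split.
  move=> v; have [G [GP GT linG [M M0 bd]]] := resolvent_exists.
  have [y yP] := resolvent_adjoint M0 linG bd v.
  have [Ty Tyv] : dom Ta y /\ Ta y = v + lam^* *: y.
    apply: adjointE => x Tx; rewrite (formDr hE) (formZr hE) conjK.
    have := yP (T x - lam *: x); rewrite GT // => ->.
    by rewrite (formBl hE) (formZl hE) subrK.
  by exists y => //; rewrite Tyv addrK.
have [surj [M M0 below]] := resT; exists M => // y Ty.
have [x Tx xy] := surj y.
have := adjoint_shift Tx Ty; rewrite xy (form_normE hE) => h.
have := cauchy_schwarz hE x (Ta y - lam^* *: y).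
rewrite -h normc_real ger0_norm ?sqr_ge0 //.
have := below x Tx; rewrite xy.
move: (form_norm_ge0 ip y) (form_norm_ge0 ip x) (form_norm_ge0 ip (Ta y - lam^*
  *: y)).
move: (nm y) (nm x) (nm (Ta y - _)) => p q r p0 q0 r0 h1 h2.
have [->|pn0] := eqVneq p 0; first by rewrite mulr_ge0.
have pgt : 0 < p by rewrite lt_def pn0.
rewrite -(ler_pM2l pgt); nra.
Qed.

(** The content is that [T] is its own second adjoint.  If [y] is in the domain of
    the second adjoint with value [z], the solution [a] of
    [T a - lam *: a = z - lam *: y] differs from [y] by a vector orthogonal to
      the
    range of [Ta - lam^*], which is everything. *)
Lemma adjoint_dual_pair : dual_pair T Ta.
Proof.
have [surja _] := adjoint_resolvent_point; have [surj _] := resT.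
split=> //; first exact: adjoint_linear.
- move=> y Ty; have [a Ta_ aE] := surj y.
  suff a0 : a = 0 by rewrite -aE a0 (linear_op0 linT) scaler0 subr0.
  apply: (form_eq0 hE); have [x Tx xE] := surja a.
  by rewrite -{2}xE -adjoint_shift // aE (formC hE) Ty // conj0.
- by move=> x y Tx Ty; exact: adjointP.
- by move=> y z yz; exists z.
move=> y z yz; have [a Ta_ aE] := surj (z - lam *: y).
suff -> : y = a by [].
apply/eqP; rewrite -subr_eq0; apply/eqP; apply: (form_eq0 hE).
have [x Tx xE] := surja (y - a).
have h : ip (Ta x - lam^* *: x) a = ip x (T a - lam *: a).
  by rewrite (formC hE) -adjoint_shift // -(formC hE).
rewrite -{1}xE (formBr hE) h aE (formBl hE) yz // (formZl hE).
by rewrite (formBr hE) (formZr hE) subrr.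
Qed.

End Resolvent.
End Resolvents.

Section Blocks.
Context {R : realType}.
Variables (E : lmodType R[i]) (ip : E -> E -> R[i]).
Hypothesis hE : hilbert_form ip.
Local Notation nm := (form_norm ip).
Local Notation ip2 := (prod_ip ip).
Local Notation nm2 := (form_norm (prod_ip ip)).

Lemma prod_form_norm_sq x : nm2 x ^+ 2 = nm x.1 ^+ 2 + nm x.2 ^+ 2.
Proof.
rewrite !(form_norm_sq hE) -ReD sqr_sqrtr // ReD addr_ge0 //.
  by rewrite -(form_norm_sq hE) sqr_ge0.
by rewrite -(form_norm_sq hE) sqr_ge0.
Qed.

Lemma prod_form_norm_fst x : nm x.1 <= nm2 x.
Proof.
rewrite -(@ler_pXn2r _ 2) ?nnegrE ?form_norm_ge0 // prod_form_norm_sq.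
by rewrite lerDl sqr_ge0.
Qed.

Lemma prod_form_norm_snd x : nm x.2 <= nm2 x.
Proof.
rewrite -(@ler_pXn2r _ 2) ?nnegrE ?form_norm_ge0 // prod_form_norm_sq.
by rewrite lerDr sqr_ge0.
Qed.

Lemma prod_form_norm_le x : nm2 x <= nm x.1 + nm x.2.
Proof.
rewrite -(@ler_pXn2r _ 2) ?nnegrE ?addr_ge0 ?form_norm_ge0 // prod_form_norm_sq.
by have := form_norm_ge0 ip x.1; have := form_norm_ge0 ip x.2; nra.
Qed.

Lemma prod_hilbert_form : hilbert_form ip2.
Proof.
split.
- by move=> a x y z; rewrite /prod_ip /= !(formP hE) mulrDr addrACA.
- by move=> x y; rewrite /prod_ip conjD -!(formC hE).
- by move=> x; rewrite addr_ge0 // (form_ge0 hE).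
- move=> x /eqP; rewrite paddr_eq0 ?(form_ge0 hE) // => /andP[/eqP h1 /eqP h2].
  by rewrite [x]surjective_pairing (form_eq0 hE h1) (form_eq0 hE h2).
move=> u cu.
have [l1 h1] : exists l, forall e : R, 0 < e -> exists N, forall n, (N <= n)%N
  ->
    nm ((u n).1 - l) < e.
  apply: (form_complete hE) => e /cu[N NP]; exists N => m n Nm Nn.
  exact: le_lt_trans (prod_form_norm_fst (u m - u n)) (NP _ _ Nm Nn).
have [l2 h2] : exists l, forall e : R, 0 < e -> exists N, forall n, (N <= n)%N
  ->
    nm ((u n).2 - l) < e.
  apply: (form_complete hE) => e /cu[N NP]; exists N => m n Nm Nn.
  exact: le_lt_trans (prod_form_norm_snd (u m - u n)) (NP _ _ Nm Nn).
exists (l1, l2) => e e0.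
have [N1 N1P] := h1 _ (divr_gt0 e0 (ltr0n R 2)).
have [N2 N2P] := h2 _ (divr_gt0 e0 (ltr0n R 2)).
exists (maxn N1 N2) => n; rewrite geq_max => /andP[/N1P nl1 /N2P nl2].
by apply: le_lt_trans (prod_form_norm_le _) _; rewrite [ltRHS]splitr ltrD.
Qed.

Variables (A1 A2 S W : operator E E).
Hypothesis dual : dual_pair ip A1 A2.
Hypotheses (linS : linear_op S) (linW : linear_op W).
Hypotheses (domS : dom A1 `<=` dom S) (domW : dom A2 `<=` dom W).
Hypotheses (symS : symmetric_op ip S) (symW : symmetric_op ip W).

(** The block operator [(S, - A2; - A1, W)] is split as [corner_free_op], which has
    a zero in place of [S], plus [corner_op], which has only [S]. *)
Definition corner_free_op : operator (E * E)%type (E * E)%type :=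
  Operator (dom A1 `*` dom A2) (fun x => (- A2 x.2, - A1 x.1 + W x.2)).

Definition corner_op : operator (E * E)%type (E * E)%type :=
  Operator (dom S `*` setT) (fun x => (S x.1, 0)).

Lemma corner_free_self_adjoint : self_adjoint_op ip2 corner_free_op.
Proof.
have [l1 l2 t1 t2 sym m2 m1] := dual.
split.
- split; first by split; [exact: l1.1 | exact: l2.1].
  move=> a x y [x1 x2] [y1 y2]; split.
    by split; apply: linear_op_dom.
  rewrite /= (linear_opP l1) // (linear_opP l2) //.
  rewrite (linear_opP linW); [|exact: domW | exact: domW].
  congr pair => /=; first by rewrite opprD scalerN.
  by rewrite scalerDr opprD -scalerN addrACA.
- move=> x y [x1 x2] [y1 y2]; rewrite /prod_ip /=.
  rewrite (formNl hE) (formNr hE) (formDl hE) (formDr hE) (formNl hE) (formNr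
    hE).
  rewrite sym // symW; [|exact: domW | exact: domW].
  by rewrite (formC hE) -sym // -(formC hE) addrCA.
- move=> y hy; rewrite [y]surjective_pairing; congr pair.
    apply: t1 => x Ax; have := hy (x, 0); rewrite /prod_ip /= (form0l hE) addr0.
    by apply; split=> //; exact: l2.1.
  apply: t2 => x Ax; have := hy (0, x); rewrite /prod_ip /= (form0l hE) add0r.
  by apply; split=> //; exact: l1.1.
move=> y z yz.
have y2 : dom A2 y.2.
  apply: (m2 _ (- z.1)) => x Ax.
  have := yz (x, 0); rewrite /prod_ip /= (linear_op0 l2) (linear_op0 linW).
  rewrite oppr0 addr0 !(form0l hE) add0r addr0 (formNl hE) (formNr hE).
  by move=> <-; [rewrite opprK | split=> //; exact: l2.1].
split=> //; apply: (m1 _ (W y.2 - z.2)) => x Ax.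
have := yz (0, x); rewrite /prod_ip /= (linear_op0 l1).
rewrite oppr0 add0r !(form0l hE) add0r (formNl hE) (formBr hE).
rewrite symW; [|exact: domW | exact: domW].
by move=> <-; [ring | split=> //; exact: l1.1].
Qed.

(** The second component of [corner_free_op] controls [A1 x1] only up to [W x2],
    which the first component controls because [W] is [A2]-bounded.  Hence [S],
    which has [A1]-bound zero, has relative bound zero with respect to
    [corner_free_op]. *)
Lemma block_self_adjoint (a b : R) : 0 <= a -> 0 <= b ->
  (forall x, dom A2 x -> nm (W x) <= a * nm (A2 x) + b * nm x) ->
  (forall e : R, 0 < e -> exists2 c : R, 0 <= c &
     forall x, dom A1 x -> nm (S x) <= e * nm (A1 x) + c * nm x) ->
  self_adjoint_op ip2 (add_op corner_free_op corner_op).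
Proof.
move=> a0 b0 bdW bdS.
(* a relative constant e costs a factor 1 + a in passing from A1 to the block *)
pose e := (4 * (1 + a))^-1.
have a1 : 0 < 1 + a by lra.
have e0 : 0 < e by rewrite invr_gt0 mulr_gt0.
have ea : e * (1 + a) = 4^-1.
  by rewrite /e invfM mulfVK // gt_eqF.
have [c c0 hc] := bdS e e0.
apply: (@kato_rellich _ _ _ prod_hilbert_form _ _ (2 * (e * b + c) ^+ 2)).
- exact: corner_free_self_adjoint.
- split; first by split=> //; exact: linS.1.
  move=> k x y [x1 _] [y1 _]; split; first by split=> //; exact: linear_op_dom.
  by rewrite /= (linear_opP linS) //; congr pair; rewrite /= scaler0 addr0.
- by move=> x [x1 _]; split=> //; exact: domS.
- move=> x y [x1 _] [y1 _]; rewrite /prod_ip /= (form0l hE) (form0r hE) !addr0.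
  by apply: symS; exact: domS.
move=> x [x1 x2].
have nS : nm2 (corner_op x) = nm (S x.1).
  apply/eqP; rewrite -(@eqrXn2 _ 2) ?form_norm_ge0 // prod_form_norm_sq /=
    (form_norm0 hE).
  by rewrite expr0n addr0.
rewrite nS.
have key : nm (S x.1) <= 4^-1 * nm2 (corner_free_op x) + (e * b + c) * nm2 x.
  have := hc _ x1; have := bdW _ x2.
  have := form_normD hE (- A1 x.1 + W x.2) (- W x.2);
    rewrite addrK !(form_normN hE).
  have := prod_form_norm_fst (corner_free_op x); rewrite /= (form_normN hE).
  have := prod_form_norm_snd (corner_free_op x) => /=.
  have := prod_form_norm_fst x; have := prod_form_norm_snd x; rewrite -ea.
  move: (nm (S _)) (nm2 _) (nm2 x) (nm (A1 _)) (nm (W _)) (nm (A2 _)) => s t n.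
  move: (nm x.1) (nm x.2) (nm (- _ + _)) => n1 n2 u p q r h1 h2 h3 h4 h5 h6 h7.
  have : e * p <= e * (t + (a * t + b * n)).
        rewrite ler_pM2l //; have : a * r <= a * t by exact: ler_wpM2l.
    have : b * n2 <= b * n by exact: ler_wpM2l.
    by lra.
  have : c * n1 <= c * n by exact: ler_wpM2l.
  by lra.
have t0 := form_norm_ge0 ip2 (corner_free_op x); have n0 := form_norm_ge0 ip2 x.
have s0 := form_norm_ge0 ip (S x.1).
have g0 : 0 <= e * b + c by rewrite addr_ge0 // mulr_ge0 // ltW.
move: (nm (S _)) (nm2 _) (nm2 x) (e * b + c) key t0 n0 s0 g0 => s t n g *.
have gn0 : 0 <= g * n by rewrite mulr_ge0.
have : s ^+ 2 <= (4^-1 * t + g * n) ^+ 2.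
  by rewrite ler_pXn2r ?nnegrE // addr_ge0 // mulr_ge0.
have := sqr_ge0 (4^-1 * t - g * n); have := sqr_ge0 t.
nra.
Qed.

End Blocks.

(** * Hilbert spaces as Hilbert forms, and the Hamiltonian matrix *)

Section NormedSpaces.
Context {R : realType}.
Variables (X : completeNormedModType R[i]) (dot : {dot X for Num.conj}).
Hypothesis hdot : norm_from_dot dot.
Local Notation nm := (form_norm dot).

Lemma form_norm_norm (x : X) : (nm x)%:C%C = `|x|.
Proof.
apply/eqP; rewrite -(@eqrXn2 _ 2) ?normr_ge0 ?ler0c ?form_norm_ge0 //.
rewrite hdot -rmorphXn /= sqr_sqrtr.
  by have := dnorm_ge0 dot x; rewrite lecE => /andP[/eqP im0 _];
    case: (dot x x) im0 => a b /= ->.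
by have := dnorm_ge0 dot x; rewrite lecE => /andP[].
Qed.

Lemma form_norm_lt (x : X) (e : R) : (nm x < e) = (`|x| < e%:C%C).
Proof. by rewrite -form_norm_norm ltcR. Qed.

Lemma dot_hilbert_form : hilbert_form dot.
Proof.
split.
- by move=> a x y z; exact: linearPl.
- by move=> x y; rewrite hermC expr0 mul1r.
- exact: dnorm_ge0.
- by move=> x /eqP; rewrite dnorm_eq0 => /eqP.
move=> u cu.
have cvu : cvg (u @ \oo).
  apply: cauchy_cvg; apply/cauchy_ballP => e e0.
  have eE : e = (complex.Re e)%:C%C by rewrite RRe_real // gtr0_real.
  have e1 : 0 < complex.Re e by rewrite -ltcR -eE.
  have [N NP] := cu _ e1.
  exists ([set u n | n in [set n | (N <= n)%N]], [set u n | n in [set n | (N <=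
    n)%N]]).
    by split; exists N => // n /= Nn; exists n.
  move=> [_ _] [[m Nm <-] [n Nn <-]] /=.
  by rewrite -ball_normE /= eE -form_norm_lt; exact: NP.
exists (lim (u @ \oo)) => e e0.
have e1 : 0 < e%:C%C :> R[i] by rewrite ltcR.
move/cvgrPdist_lt: cvu => /(_ _ e1) [N _ NP].
exists N => n /NP /=; rewrite form_norm_lt distrC; exact.
Qed.

Lemma dense_adherent (S : set X) : dense S -> forall x, adherent dot S x.
Proof.
move=> dS x e e0.
have e1 : 0 < e%:C%C :> R[i] by rewrite ltcR.
have [||m [xm Sm]] := dS (ball x e%:C%C).
- by exists x; exact: ballxx.
- exact: ball_open.
by exists m => //; rewrite form_norm_lt; move: xm; rewrite -ball_normE.
Qed.

Lemma resolvent_set_point (T : operator X X) lam :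
  resolvent_set T lam -> resolvent_point dot T lam.
Proof.
move=> [[_ _ surj] [M MP]]; split=> [w|].
  by have [x Tx xw] := surj w I; exists x.
exists `|M| => // x Tx; have := MP x Tx.
rewrite -!form_norm_norm -rmorphM lecR => /le_trans; apply.
by apply: ler_wpM2r; [exact: form_norm_ge0 | exact: ler_norm].
Qed.

(** The infimum of the admissible constants need not be attained, so the bound
    holds with every positive constant rather than with zero. *)
Lemma zero_rel_bound (S T : operator X X) :
  rel_bounded S T -> rel_bound S T = 0 ->
  forall e : R, 0 < e -> exists2 c : R, 0 <= c &
    forall x, dom T x -> nm (S x) <= e * nm (T x) + c * nm x.
Proof.
move=> [_ [a0 a0P]] b0 e e0.
have hinf : has_inf [set a : R | rel_bound_const S T a].
  by split; [exists a0 | exists 0 => a [? _]].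
have [a [_ [c [c0 cP]]]] := inf_adherent e0 hinf.
rewrite -/(rel_bound S T) b0 add0r => ae.
exists c => // x /cP; rewrite -!form_norm_norm -!rmorphM -rmorphD lecR.
move=> /le_trans; apply; rewrite lerD2r.
by apply: ler_wpM2r; [exact: form_norm_ge0 | exact: ltW].
Qed.

End NormedSpaces.

Section SelfAdjointTransfer.
Context {R : realType}.
Variables (E : lmodType R[i]) (ip : E -> E -> R[i]).
Hypothesis hE : hilbert_form ip.

Lemma self_adjoint_op_eq (T T' : operator E E) :
  self_adjoint_op ip T -> eq_operator T' T -> self_adjoint ip T'.
Proof.
move=> saT [domE TE].
have rel y : dom T y -> adjoint_rel ip T' y (T' y).
  by move=> Ty x; rewrite domE => Tx; rewrite !TE // (sa_symmetric saT).
have relT y z : adjoint_rel ip T' y z -> adjoint_rel ip T y z.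
  by move=> yz x Tx; rewrite -TE //; apply: yz; rewrite domE.
split.
  rewrite domE; apply/seteqP; split=> y.
    by move=> Ty; exists (T' y); exact: rel.
  by move=> [z /relT]; exact: sa_maximal.
move=> y [z yz].
have Ty : dom T y by exact: sa_maximal (relT _ _ yz).
have tot : total ip (dom T') by rewrite domE; exact: sa_total.
exact: (adjoint_rel_unique hE tot (rel y Ty) (xgetPex 0 (ex_intro _ z yz))).
Qed.

Definition swap_op (T : operator (E * E)%type (E * E)%type) :
    operator (E * E)%type (E * E)%type :=
  Operator [set x | dom T (x.2, x.1)]
           (fun x => ((T (x.2, x.1)).2, (T (x.2, x.1)).1)).

Lemma swap_self_adjoint T :
  self_adjoint_op (prod_ip ip) T -> self_adjoint_op (prod_ip ip) (swap_op T).
Proof.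
move=> [lin sym tot max].
have ipC (x y : E * E) : prod_ip ip (x.2, x.1) (y.2, y.1) = prod_ip ip x y.
  by rewrite /prod_ip addrC.
split.
- split; first exact: lin.1.
  move=> a x y Tx Ty; have [Txy TE] := lin.2 a _ _ Tx Ty; split;
    first exact: Txy.
  by have := TE => /= ->.
- move=> x y Tx Ty; rewrite -(ipC _ y) -(ipC x).
  have := sym _ _ Tx Ty => /=; rewrite -!surjective_pairing; exact.
- move=> y hy; suff [h2 h1] : (y.2, y.1) = 0.
    by rewrite [y]surjective_pairing h1 h2.
  apply: tot => x Tx; rewrite -(ipC x) /= -surjective_pairing.
  by apply: hy; rewrite /swap_op /= -surjective_pairing.
move=> y z yz; apply: (max _ (z.2, z.1)) => x Tx.
rewrite -(ipC _ (y.2, y.1)) -(ipC x) /= -!surjective_pairing.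
have := yz (x.2, x.1); rewrite /= -surjective_pairing; exact.
Qed.

End SelfAdjointTransfer.

Lemma opp_op_linear (R : realType) (E : lmodType R[i]) (T : operator E E) :
  linear_op T -> linear_op (opp_op T).
Proof.
move=> lin; split=> [|a x y Tx Ty]; first exact: lin.1.
split; first exact: (linear_op_dom lin).
by rewrite /= (linear_opP lin) // opprD scalerN.
Qed.

Theorem corollary3p1 (R : realType) (X : completeNormedModType R[i])
    (dot : {dot X for Num.conj}) (hdot : norm_from_dot dot)
    (A B C : operator X X) (hH : is_hamiltonian dot A B C)
    (hdom : dom (hamiltonian_op dot A B C) = dom A `*` dom (adjoint dot A))
    (hrho : resolvent_set A !=set0)
    (hrel : (rel_bounded C A /\ rel_bound C A = 0) \/
            (rel_bounded B (adjoint dot A) /\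
             rel_bound B (adjoint dot A) = 0)) :
  eq_operator
    (comp_op (J_op X) (hamiltonian_op dot A B C))
    (adjoint (prod_ip dot) (comp_op (J_op X) (hamiltonian_op dot A B C))).
Proof.
have [[linA _ dA] [linB _ dB] [linC _ dC] [[domB eqB] [domC eqC]] _] := hH.
have hX := dot_hilbert_form hdot.
have [lam /(resolvent_set_point hdot) resA] := hrho.
have totA : total dot (dom A).
  by apply: (dense_total hX); exact: dense_adherent.
have resAs := adjoint_resolvent_point hX linA resA totA.
have dual := adjoint_dual_pair hX linA resA totA.
have linAs := dual_linear2 dual.
have symm (T : operator X X) : self_adjoint dot T -> symmetric_op dot T.
  move=> [domT eqT] x y Tx Ty; rewrite (eqT y) -?domT //.
  by apply: adjointP => //; rewrite -domT.
have symB : symmetric_op dot B by exact: symm.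
have symC : symmetric_op dot C by exact: symm.
have As0 : dom (adjoint dot A) 0 by exact: linAs.1.
have sub x y : dom A x -> dom (adjoint dot A) y -> dom C x /\ dom B y.
  move=> Ax Ay; have : (dom A `*` dom (adjoint dot A)) (x, y) by [].
  by rewrite -hdom => -[[_ ?] [? _]].
have subC : dom A `<=` dom C by move=> x Ax; have [] := sub x 0 Ax As0.
have subB : dom (adjoint dot A) `<=` dom B.
  by move=> y Ay; have [] := sub 0 y linA.1 Ay.
have domJH : dom (comp_op (J_op X) (hamiltonian_op dot A B C)) =
    dom A `*` dom (adjoint dot A).
  by rewrite -hdom; apply/seteqP; split=> [x []|x Hx].
have h2 := prod_hilbert_form hX.
case: hrel => [[bdC bC0]|[bdB bB0]].
  have [a [b [a0 b0 bd]]] :=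
    symmetric_rel_bounded hX linAs resAs linB (dense_adherent hdot dB)
      symB subB.
  apply: (self_adjoint_op_eq h2 (@block_self_adjoint _ _ _ hX
    A (adjoint dot A) C (opp_op B) dual linC (opp_op_linear linB)
    subC subB symC _ a b a0 b0 _ (zero_rel_bound hdot bdC bC0))).
  - by move=> x y Bx By; rewrite /= (formNl hX) (formNr hX) symB.
  - by move=> x Ax; rewrite /= (form_normN hX); exact: bd.
  split; first exact: domJH.
  move=> [x1 x2] _ /=; congr pair; first by rewrite add0r addrC.
  by rewrite !addr0 opprD.
have [a [b [a0 b0 bd]]] :=
  symmetric_rel_bounded hX linA resA linC (dense_adherent hdot dC) symC subC.
have sa := @block_self_adjoint _ _ _ hX (adjoint dot A) A (opp_op B) C
  (dual_pairC hX dual) (opp_op_linear linB) linC subB subC _ symC a b a0 b0 bd.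
apply: (self_adjoint_op_eq h2 (swap_self_adjoint (sa _ _))).
- by move=> x y Bx By; rewrite /= (formNl hX) (formNr hX) symB.
- move=> e /(zero_rel_bound hdot bdB bB0)[c c0 hc]; exists c => // x Ax.
  by rewrite /= (form_normN hX); exact: hc.
split; first by rewrite domJH; apply/seteqP; split=> x [].
move=> [x1 x2] _ /=; congr pair; first by rewrite add0r addr0 addrC.
by rewrite addr0 opprD.
Qed.
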